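(* Let $\{x_k\}_{k\ge1}$ be generated by the SQN iteration described in the context, suppose that assumptions AS.1, AS.2, AS.3 and AS.4 (stated in the context) hold, and suppose the batch size is constant, $m_k=m$ for all $k$. Assume that the step sizes satisfy $$\sum_{k=1}^{\infty}\alpha_k=+\infty,\qquad \sum_{k=1}^{\infty}\alpha_k^2<+\infty,$$ and $\alpha_k\le \dfrac{\underline{\kappa}}{L\bar{\kappa}^2}$ for all $k$. Assume in addition that there is a constant $M_g>0$ such that for every $k$ and each sample $\xi$ of iteration $k$, $\mathbb{E}_{\xi}[\|g(x_k,\xi)\|^2]\le M_g$ (expectation over the sample). Then $$\lim_{k\to\infty}\|\nabla f(x_k)\|=0\quad\text{with probability }1.$$
   Context: Setting. $f(x)=\mathbb{E}[F(x,\xi)]$ for $x\in\mathbb{R}^n$, where $F:\mathbb{R}^n\times\mathbb{R}^d\to\mathbb{R}$ is continuously differentiable and possibly nonconvex and $\xi$ is a random vector in $\mathbb{R}^d$. A stochastic first-order oracle returns, for given $x$ and a sample $\xi$, a stochastic gradient $g(x,\xi)\in\mathbb{R}^n$; the distribution of $\xi$ is supported on a set $\Xi\subseteq\mathbb{R}^d$ not depending on $x$. $\|\cdot\|$ is the Euclidean norm, and $A\preceq B$ means $B-A$ is positive semidefinite. SQN (stochastic quasi-Newton) iteration. Given are $x_1\in\mathbb{R}^n$, a positive definite $H_1\in\mathbb{R}^{n\times n}$, batch sizes $m_k\ge 1$ and step sizes $\alpha_k>0$. At iteration $k=1,2,\ldots$: draw samples $\xi_k=(\xi_{k,1},\ldots,\xi_{k,m_k})$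 and set $g_k=\frac1{m_k}\sum_{i=1}^{m_k}g(x_k,\xi_{k,i})$; generate a positive definite matrix $H_k$; set $x_{k+1}=x_k-\alpha_kH_kg_k$. Write $\xi_{[k]}=(\xi_1,\ldots,\xi_k)$. Assumptions. AS.1: $f:\mathbb{R}^n\to\mathbb{R}$ is continuously differentiable, $f(x)\ge f^{low}$ for all $x$ for some real $f^{low}$, and $\|\nabla f(x)-\nabla f(y)\|\le L\|x-y\|$ for all $x,y\in\mathbb{R}^n$. AS.2: all samples are independent, the samples of iteration $k$ are independent of $\{x_j\}_{j=1}^k$, and for each $k$ and each sample $\xi$ of iteration $k$ (expectation over that sample) $\mathbb{E}_{\xi}[g(x_k,\xi)]=\nabla f(x_k)$ and $\mathbb{E}_{\xi}[\|g(x_k,\xi)-\nabla f(x_k)\|^2]\le\sigma^2$, with $\sigma>0$. AS.3: there are positive constants $\underline{\kappa},\bar{\kappa}$ with $\underline{\kappa}I\preceq H_k\preceq\bar{\kappa}I$ for all $k$. AS.4: for every $k\ge2$, the random matrix $H_k$ depends only on $\xi_{[k-1]}$. *)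

(* Defs.v *)
From HB Require Import structures.
From mathcomp Require Import all_boot all_order all_algebra.
From mathcomp Require Import finmap.
From mathcomp Require Import all_classical all_reals all_analysis.

Set Implicit Arguments.
Unset Strict Implicit.
Unset Printing Implicit Defensive.

Import Order.TTheory GRing.Theory Num.Theory.
Import numFieldNormedType.Exports.

Local Open Scope classical_set_scope.
Local Open Scope ring_scope.

(* MathComp's norm on matrices is the sup norm (same topology). *)
Definition enorm (R : realType) (n : nat) (v : 'cV[R]_n) : R :=
  Num.sqrt (\sum_i v i 0 ^+ 2).

(* Symmetry is part of (semi)definiteness, as usual for real matrices. *)
Definition posdef (R : realType) (n : nat) (A : 'M[R]_n) : Prop :=
  A^T = A /\ forall v : 'cV[R]_n, v != 0 -> 0 < (v^T *m A *m v) 0 0.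

Definition possemidef (R : realType) (n : nat) (A : 'M[R]_n) : Prop :=
  A^T = A /\ forall v : 'cV[R]_n, 0 <= (v^T *m A *m v) 0 0.

Definition loewner_le (R : realType) (n : nat) (A B : 'M[R]_n) : Prop :=
  possemidef (B - A).

Definition grad (R : realType) (n : nat) (f : 'cV[R]_n -> R) (x : 'cV[R]_n)
  : 'cV[R]_n := \col_i 'D_(delta_mx i 0) f x.

(* [V] is always finite-dimensional here, so that continuity of every
   directional derivative is continuity of the differential. *)
Definition continuously_differentiable (R : realType) (V : normedModType R)
    (f : V -> R) : Prop :=
  (forall x, differentiable f x) /\ (forall v, continuous (fun x => 'D_v f x)).

(* The library puts no sigma-algebra on matrices. *)
Definition Borel (T : ptopologicalType) := g_sigma_algebraType (@open T).

Section Independence.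
Context {d dS : measure_display} {Omega : measurableType d}
  {S : measurableType dS} {R : realType} (P : probability Omega R).

Definition mutually_independent (I : choiceType) (D : set I)
    (X : I -> Omega -> S) : Prop :=
  forall (J : {fset I}) (B : I -> set S),
    [set` J] `<=` D -> (forall i, measurable (B i)) ->
    (P (\bigcap_(i in [set` J]) (X i @^-1` B i)) =
     \prod_(i <- J) P (X i @^-1` B i))%E.

Definition sigma_generated (I : Type) (D : set I) (X : I -> Omega -> S)
  : set (set Omega) :=
  <<s \bigcup_(i in D) preimage_set_system setT (X i) measurable >>.

Definition independent_sigma (G1 G2 : set (set Omega)) : Prop :=
  forall A B, G1 A -> G2 B -> (P (A `&` B) = P A * P B)%E.

End Independence.

Section SQN.
Context {dO : measure_display} {Omega : measurableType dO} {R : realType}.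
Variables (P : probability Omega R) (n d : nat).

(* Iterations are numbered from 1, so index 0 of every sequence below is
   irrelevant.  The samples of iteration k are xi (k, 0), ..., xi (k, m k - 1). *)
Implicit Types (f : 'cV[R]_n -> R) (F : 'cV[R]_n * 'cV[R]_d -> R)
  (g : 'cV[R]_n -> 'cV[R]_d -> 'cV[R]_n) (m : nat -> nat)
  (xi : nat * nat -> Omega -> 'cV[R]_d) (x : nat -> Omega -> 'cV[R]_n)
  (H : nat -> Omega -> 'M[R]_n) (alpha : nat -> R).

(* nu is the law of the random vector in f(x) = E[F(x, .)]. *)
Record stochastic_objective (Xi : set 'cV[R]_d)
    (nu : probability (Borel 'cV[R]_d) R) F f : Prop := {
  so_C1 : continuously_differentiable F;
  so_support : {ae nu, forall z, Xi z};
  so_expectation : forall y, ('E_nu[fun z => F (y, z)] = (f y)%:E)%E }.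

Definition sample_index m (k : nat) : set (nat * nat) :=
  [set p | p.1 = k /\ (p.2 < m k)%N].

Definition past_index m (k : nat) : set (nat * nat) :=
  [set p | [/\ (0 < p.1)%N, (p.1 < k)%N & (p.2 < m p.1)%N]].

Definition all_index m : set (nat * nat) :=
  [set p | (0 < p.1)%N /\ (p.2 < m p.1)%N].

(* Joint measurability makes g(x_k, xi) a random vector.  The samples need not
   be identically distributed: each one has its own law carried by Xi, and the
   moment conditions below are imposed sample by sample. *)
Record stochastic_oracle (Xi : set 'cV[R]_d) g m xi : Prop := {
  oracle_measurable : measurable_fun setT
    ((fun p => g p.1 p.2) :
       Borel 'cV[R]_n * Borel 'cV[R]_d -> Borel 'cV[R]_n);
  sample_measurable : forall p, all_index m p ->
    measurable_fun setT (xi p : Omega -> Borel 'cV[R]_d);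
  sample_support : forall p, all_index m p -> {ae P, forall w, Xi (xi p w)} }.

Definition batch_gradient g m xi x (k : nat) (w : Omega) : 'cV[R]_n :=
  (m k)%:R^-1 *: \sum_(i < m k) g (x k w) (xi (k, val i) w).

Record sqn_iteration g m xi alpha (x1 : 'cV[R]_n) (H1 : 'M[R]_n) H x : Prop := {
  sqn_batch : forall k, (0 < k)%N -> (0 < m k)%N;
  sqn_step : forall k, (0 < k)%N -> 0 < alpha k;
  sqn_x1 : forall w, x 1%N w = x1;
  sqn_H1 : forall w, H 1%N w = H1;
  sqn_posdef : forall k w, (0 < k)%N -> posdef (H k w);
  sqn_next : forall k w, (0 < k)%N ->
    x k.+1 w = x k w - alpha k *: (H k w *m batch_gradient g m xi x k w) }.

Record smooth_bounded_below f (L flow : R) : Prop := {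
  sbb_C1 : continuously_differentiable f;
  sbb_lower : forall y, flow <= f y;
  sbb_L_gt0 : 0 < L;
  sbb_lipschitz : forall y z,
    enorm (grad f y - grad f z) <= L * enorm (y - z) }.

(* In the expectations over a single sample, x_k(w) is held fixed and only the
   sample is integrated out; the resulting functions of w are compared P-a.s. *)
Record unbiased_bounded_variance f g m xi x (sigma : R) : Prop := {
  ubv_sigma_gt0 : 0 < sigma;
  ubv_samples : mutually_independent P (all_index m)
    (xi : nat * nat -> Omega -> Borel 'cV[R]_d);
  ubv_iterates : forall k, (0 < k)%N ->
    independent_sigma P
      (sigma_generated (sample_index m k)
         (xi : nat * nat -> Omega -> Borel 'cV[R]_d))
      (sigma_generated [set j | (0 < j <= k)%N]
         (x : nat -> Omega -> Borel 'cV[R]_n));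
  ubv_mean : forall k i, (0 < k)%N -> (i < m k)%N ->
    {ae P, forall w, forall j,
      ('E_P[fun w' => g (x k w) (xi (k, i) w') j 0%R]
       = (grad f (x k w) j 0%R)%:E)%E};
  ubv_variance : forall k i, (0 < k)%N -> (i < m k)%N ->
    {ae P, forall w,
      ('E_P[fun w' =>
         (enorm (g (x k w) (xi (k, i) w') - grad f (x k w)) ^+ 2)%R]
       <= (sigma ^+ 2)%:E)%E} }.

Record uniformly_definite H (kl ku : R) : Prop := {
  ud_kl_gt0 : 0 < kl;
  ud_ku_gt0 : 0 < ku;
  ud_bounds : {ae P, forall w, forall k, (0 < k)%N ->
    loewner_le kl%:M (H k w) /\ loewner_le (H k w) ku%:M} }.

(* "H_k depends only on the past samples": measurability with respect to the
   sigma-algebra they generate.  H_1 is deterministic by [sqn_H1]. *)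
Definition past_dependent m xi H : Prop :=
  forall k, (2 <= k)%N -> forall B : set (Borel 'M[R]_n), measurable B ->
    sigma_generated (past_index m k)
      (xi : nat * nat -> Omega -> Borel 'cV[R]_d) (H k @^-1` B).

Definition bounded_second_moment g m xi x (Mg : R) : Prop :=
  0 < Mg /\
  forall k i, (0 < k)%N -> (i < m k)%N ->
    {ae P, forall w,
      ('E_P[fun w' => (enorm (g (x k w) (xi (k, i) w')) ^+ 2)%R] <= Mg%:E)%E}.

End SQN.

(* Main.v *)
(* Conditionally on the past, the expectation of f (x_k+1) is at most
   f (x_k) - alpha_k kl |grad f (x_k)|^2 + O(alpha_k^2).  Summing expectations,
   sum_k alpha_k E |grad f (x_k)|^2 is finite, and since a sample is independent
   of the past and has second moment at most Mg, so is
   sum_k alpha_k E (|grad f (x_k)|^2 (1 + |g_k|^2)).  Hence almost surely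
   sum_k alpha_k G_k^2 (1 + |g_k|^2) and sum_k alpha_k^2 |g_k|^2 converge, where
   G_k = |grad f (x_k)|.  As |G_k+1 - G_k| <= L ku alpha_k |g_k|, the increments
   of G_k^3 are then absolutely summable: G_k^3 converges, and its limit is 0
   because sum_k alpha_k G_k^2 is finite while sum_k alpha_k is not.  No
   martingale convergence theorem is needed. *)
Require Import Defs.
From HB Require Import structures.
From mathcomp Require Import all_boot all_order all_algebra.
From mathcomp Require Import finmap.
From mathcomp Require Import all_classical all_reals all_analysis.
From mathcomp Require Import measurable_realfun ring lra.

Set Implicit Arguments.
Unset Strict Implicit.
Unset Printing Implicit Defensive.

Import Order.TTheory GRing.Theory Num.Theory.
Import numFieldNormedType.Exports.

Local Open Scope classical_set_scope.
Local Open Scope ring_scope.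

(** * Euclidean norm *)

Section EuclideanNorm.
Context {R : realType} {n : nat}.
Implicit Types (u v : 'cV[R]_n) (A : 'M[R]_n).

Definition dot u v : R := \sum_i u i 0 * v i 0.

Lemma dotE u v : dot u v = (u^T *m v) 0 0.
Proof. by rewrite mxE; apply: eq_bigr => i _; rewrite mxE. Qed.

Lemma dotC u v : dot u v = dot v u.
Proof. by apply: eq_bigr => i _; rewrite mulrC. Qed.

Lemma dotDr u v w : dot u (v + w) = dot u v + dot u w.
Proof.
by rewrite -big_split; apply: eq_bigr => i _; rewrite mxE mulrDr.
Qed.

Lemma dotZr a u v : dot u (a *: v) = a * dot u v.
Proof. by rewrite mulr_sumr; apply: eq_bigr => i _; rewrite mxE mulrCA. Qed.

Lemma dotNr u v : dot u (- v) = - dot u v.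
Proof. by rewrite -scaleN1r dotZr mulN1r. Qed.

Lemma dot_sumr m u (v : 'I_m -> 'cV[R]_n) :
  dot u (\sum_k v k) = \sum_k dot u (v k).
Proof.
rewrite /dot exchange_big; apply: eq_bigr => i _.
by rewrite summxE mulr_sumr.
Qed.

Lemma dotDl u v w : dot (u + v) w = dot u w + dot v w.
Proof. by rewrite dotC dotDr !(dotC w). Qed.

Lemma dotZl a u v : dot (a *: u) v = a * dot u v.
Proof. by rewrite dotC dotZr dotC. Qed.

Lemma dotNl u v : dot (- u) v = - dot u v.
Proof. by rewrite dotC dotNr dotC. Qed.

Lemma dot_ge0 v : 0 <= dot v v.
Proof. by apply: sumr_ge0 => i _; rewrite -expr2 sqr_ge0. Qed.

Lemma dot_mulmx_tr A u v : dot u (A *m v) = dot (A^T *m u) v.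
Proof. by rewrite !dotE trmx_mul trmxK mulmxA. Qed.

Lemma enorm_ge0 v : 0 <= enorm v. Proof. exact: sqrtr_ge0. Qed.

Lemma sqr_enorm v : enorm v ^+ 2 = dot v v.
Proof.
rewrite sqr_sqrtr; first by apply: eq_bigr => i _; rewrite expr2.
by apply: sumr_ge0 => i _; rewrite sqr_ge0.
Qed.

Lemma enorm_le v (a : R) : 0 <= a -> dot v v <= a ^+ 2 -> enorm v <= a.
Proof. by move=> a0; rewrite -sqr_enorm ler_sqr ?nnegrE ?enorm_ge0. Qed.

Lemma dot_enorm0 u v : enorm u = 0 -> dot u v = 0.
Proof.
move=> u0; rewrite /dot big1// => i _.
have := sqr_enorm u; rewrite u0 expr0n/= => /esym/eqP.
rewrite psumr_eq0; last by move=> j _; rewrite -expr2 sqr_ge0.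
move=> /allP/(_ i (mem_index_enum _)); rewrite -expr2 sqrf_eq0.
by move=> /eqP ->; rewrite mul0r.
Qed.

(** Cauchy-Schwarz: for nonzero norms, expand the square of [enorm v *: u - enorm u *: v] and divide
    by [enorm u * enorm v]. *)
Lemma ler_dot u v : dot u v <= enorm u * enorm v.
Proof.
have [u0|u0] := eqVneq (enorm u) 0; first by rewrite dot_enorm0// u0 mul0r.
have [v0|] := eqVneq (enorm v) 0; first by rewrite dotC dot_enorm0// v0 mulr0.
move=> v0; have {}u0 : 0 < enorm u by rewrite lt_neqAle eq_sym u0 enorm_ge0.
have {}v0 : 0 < enorm v by rewrite lt_neqAle eq_sym v0 enorm_ge0.
have := dot_ge0 (enorm v *: u - enorm u *: v).
rewrite !(dotDl, dotDr, dotNl, dotNr, dotZl, dotZr).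
rewrite -!sqr_enorm (dotC v u) => h.
have : enorm u * enorm v * dot u v <= enorm u * enorm v * (enorm u * enorm v).
  by lra.
by rewrite ler_pM2l// mulr_gt0.
Qed.

Lemma ler_enormD u v : enorm (u + v) <= enorm u + enorm v.
Proof.
apply: enorm_le; first by rewrite addr_ge0// enorm_ge0.
rewrite dotDl !dotDr (dotC v u) -!sqr_enorm.
by have := ler_dot u v; lra.
Qed.

Lemma enormZ a v : enorm (a *: v) = `|a| * enorm v.
Proof.
rewrite /enorm -sqrtr_sqr -sqrtrM ?sqr_ge0// mulr_sumr; congr Num.sqrt.
by apply: eq_bigr => i _; rewrite mxE exprMn.
Qed.

Lemma enorm_dist u v : `|enorm u - enorm v| <= enorm (u - v).
Proof.
have h1 := ler_enormD (u - v) v; have h2 := ler_enormD (v - u) u.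
rewrite subrK in h1.
rewrite subrK -opprB -scaleN1r enormZ normrN1 mul1r in h2.
by rewrite ler_norml; lra.
Qed.

(** Jensen's inequality for the squared norm, read off from the nonnegative sum of squared
    deviations from the mean [z]. *)
Lemma sqr_enorm_mean m (v : 'I_m -> 'cV[R]_n) : (0 < m)%N ->
  dot (m%:R^-1 *: \sum_k v k) (m%:R^-1 *: \sum_k v k) <=
  m%:R^-1 * \sum_k dot (v k) (v k).
Proof.
move=> m0; set z := _ *: _.
have mR : 0 < m%:R :> R by rewrite ltr0n.
have : 0 <= \sum_k dot (v k - z) (v k - z) by apply: sumr_ge0 => k _; exact: dot_ge0.
under eq_bigr => k _ do rewrite dotDl !dotDr !dotNl !dotNr opprK (dotC (v k) z).
rewrite !big_split/= !sumrN sumr_const card_ord -dot_sumr.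
have -> : \sum_k v k = m%:R *: z.
  by rewrite /z scalerA divff ?scale1r// gt_eqF.
rewrite dotZr -mulr_natl => h.
rewrite mulrC ler_pdivlMr//; lra.
Qed.

(* Positivity of A on v - t A v at t = 1/k, with A <= k I on v and A v. *)
Lemma sqr_enorm_mulmx A (k : R) v : possemidef A -> 0 < k ->
  loewner_le A k%:M -> dot (A *m v) (A *m v) <= k ^+ 2 * dot v v.
Proof.
move=> [sA pA] k0 [_ lA].
have pA' w : 0 <= dot w (A *m w) by rewrite dotE mulmxA; exact: pA.
have lA' w : dot w (A *m w) <= k * dot w w.
  have := lA w; rewrite mulmxBr mulmxBl mxE [X in _ + X]mxE subr_ge0.
  by rewrite -!mulmxA -!dotE mul_scalar_mx dotZr.
have := pA' (v - k^-1 *: (A *m v)).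
rewrite mulmxBr -!scalemxAr !(dotDl, dotDr, dotNl, dotNr, dotZl, dotZr).
rewrite (dot_mulmx_tr A v (A *m v)) sA.
have h1 := lA' v; have h2 := lA' (A *m v).
set y := dot (A *m v) (A *m v) in h2 *.
set q := dot _ (A *m (A *m v)) in h2 *.
set p := dot v _ in h1 *.
move=> h3.
have ki : k * k^-1 = 1 by rewrite divff// gt_eqF.
have ki0 : 0 < k^-1 by rewrite invr_gt0.
have h4 : k^-1 ^+ 2 * q <= k^-1 * y.
  have -> : k^-1 * y = k^-1 ^+ 2 * (k * y).
    by rewrite expr2 -mulrA (mulrA _ k) mulVf ?gt_eqF// mul1r.
  by rewrite ler_pM2l// exprn_gt0.
(* Positivity reads [p - 2 k^-1 y + k^-2 q >= 0]; by [h4] the last term absorbs one of the two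
   copies of [k^-1 y], and [h1] bounds [p]. *)
have h5 : k^-1 * y <= k * dot v v by lra.
have : k * (k^-1 * y) <= k * (k * dot v v) by rewrite ler_pM2l.
by rewrite !mulrA ki mul1r -expr2.
Qed.

Lemma posdef_semidef A : posdef A -> possemidef A.
Proof.
case=> sA pA; split=> // v; have [->|/pA/ltW//] := eqVneq v 0.
by rewrite mulmx0 mxE.
Qed.

End EuclideanNorm.

(** * Gradients and Borel measurability *)

Section Gradient.
Context {R : realType} {n : nat}.
Implicit Types (f : 'cV[R]_n -> R) (x v : 'cV[R]_n).

Lemma derive_dot_grad f x v : differentiable f x -> 'D_v f x = dot (grad f x) v.
Proof.
move=> df; rewrite deriveE//.
have {1}-> : v = \sum_i v i 0 *: delta_mx i 0.
  by rewrite {1}[v]matrix_sum_delta; apply: eq_bigr => i _; rewrite big_ord1.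
rewrite linear_sum; apply: eq_bigr => i _.
by rewrite linearZ/= mxE deriveE// mulrC.
Qed.

Lemma is_derive_along_line f x v (t : R) : (forall y, differentiable f y) ->
  is_derive t 1 (fun t => f (x + t *: v)) (dot (grad f (x + t *: v)) v).
Proof.
move=> df; rewrite -derive_dot_grad//.
have dl : derivable f (x + t *: v) v by exact: diff_derivable.
have E : (fun h : R => h^-1 *: (((fun t => f (x + t *: v)) \o shift t) (h *: 1)
    - f (x + t *: v))) =
  (fun h : R => h^-1 *: ((f \o shift (x + t *: v)) (h *: v) - f (x + t *: v))).
  apply/funext => h /=; do 3 f_equal.
  by rewrite /shift/= scalerDl -[h *: 1]/(h * 1) mulr1 addrCA.
by split; rewrite /derivable /derive E.
Qed.

(* The mean value theorem gives the constant L instead of the sharp L / 2, which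
   is enough below. *)
Lemma le_taylor_lipschitz_grad f (L : R) x v : (forall y, differentiable f y) ->
  0 <= L ->
  (forall y z, enorm (grad f y - grad f z) <= L * enorm (y - z)) ->
  f (x + v) <= f x + dot (grad f x) v + L * dot v v.
Proof.
move=> df L0 lf.
pose phi (t : R) := f (x + t *: v).
have dphi (t : R) : is_derive t (1 : R) phi (dot (grad f (x + t *: v)) v).
  exact: is_derive_along_line.
have [|c] := @MVT R phi (fun t => dot (grad f (x + t *: v)) v) 0 1 ltr01
  (fun t _ => dphi t).
  apply: continuous_subspaceT => t.
  apply: differentiable_continuous; apply/derivable1_diffP.
  exact: (@ex_derive _ _ _ _ _ _ _ (dphi t)).
rewrite in_itv/= => /andP[c0 c1].
rewrite /phi scale1r scale0r addr0 subr0 mulr1 => /eqP.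
rewrite subr_eq => /eqP ->.
(* As [c] lies between 0 and 1, the gradient at the mean value point differs from the one at [x] by
   at most [L * enorm v]. *)
have : dot (grad f (x + c *: v) - grad f x) v <= L * dot v v.
  apply: le_trans (ler_dot _ _) _; rewrite -sqr_enorm expr2 mulrA.
  apply: ler_wpM2r; first exact: enorm_ge0.
  apply: le_trans (lf _ _) _; apply: ler_wpM2l => //.
  rewrite addrC addKr enormZ gtr0_norm// ler_piMl ?enorm_ge0//; exact: ltW.
rewrite dotDl dotNl; lra.
Qed.

End Gradient.

(** * Borel measurability of matrix-valued maps *)

Section BorelMeasurability.
Context {R : realType}.

Lemma continuous_Borel_measurable (T : ptopologicalType) (f : T -> R) :
  continuous f -> measurable_fun setT (f : Borel T -> R).
Proof.
move=> /continuousP cf; apply: (measurability _ (RGenOpens.measurableE R)).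
move=> _ [_ [a [b ->] <-]]; rewrite setTI.
by apply: sub_sigma_algebra; apply: cf; exact: interval_open.
Qed.

Lemma measurable_coord p q i j :
  measurable_fun setT ((fun A => A i j) : Borel 'M[R]_(p, q) -> R).
Proof. by apply: continuous_Borel_measurable; exact: coord_continuous. Qed.

(** Balls with rational centre and radius [N.+1%:R^-1] form a countable base of the topology, which
    reduces Borel measurability to countably many preimages. *)
Lemma rat_ball_subset p q (A : set 'M[R]_(p, q)) x : open A -> A x ->
  exists c : 'M[rat]_(p, q) * nat,
    ball (map_mx ratr c.1 : 'M[R]_(p, q)) c.2.+1%:R^-1 `<=` A /\
    ball (map_mx ratr c.1 : 'M[R]_(p, q)) c.2.+1%:R^-1 x.
Proof.
move=> oA Ax.
have /nbhs_ballP[e /= e0 eA] : nbhs x A by apply: open_nbhs_nbhs.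
(* With a radius [k] below [e / 2] and a centre within [k] of [x], the ball lies within [k + k] of
   [x]. *)
have e20 : 0 < e / 2 by rewrite divr_gt0.
have [N _ /(_ N (leqnn N))/=] := near_infty_natSinv_lt (PosNum e20).
have : 0 < N.+1%:R^-1 :> R by rewrite invr_gt0.
move eqk : N.+1%:R^-1 => k N0 Ne.
have ex i j : exists r : rat, `|x i j - ratr r| < k.
  have [|r] := @rat_in_itvoo R (x i j - k) (x i j + k).
    by lra.
  rewrite in_itv/= => /andP[r1 r2]; exists r.
  by rewrite ltr_norml; lra.
pose c := \matrix_(i, j) projT1 (cid (ex i j)).
have cx : ball (map_mx ratr c : 'M[R]_(p, q)) k x.
  split=> // i j; rewrite /ball/= !mxE distrC.
  exact: (projT2 (cid (ex i j))).
exists (c, N); rewrite /= eqk; split=> // y cy; apply: eA.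
apply: (@le_ball _ _ _ (k + k)); first by lra.
by apply: ball_triangle cy; exact: ball_sym.
Qed.

Lemma measurable_fun_Borel_mx d (T : measurableType d) p q
    (h : T -> 'M[R]_(p, q)) :
  (forall i j, measurable_fun setT (fun t => h t i j)) ->
  measurable_fun setT (h : T -> Borel 'M[R]_(p, q)).
Proof.
move=> mh; apply: (@measurability _ _ T (Borel 'M[R]_(p, q)) setT h (@open _)) => //.
move=> _ [A oA <-]; rewrite setTI.
(* An open set is the union of the base balls it contains; the other indices contribute the empty
   set. *)
pose F (c : 'M[rat]_(p, q) * nat) : set T :=
  if `[< ball (map_mx ratr c.1 : 'M[R]_(p, q)) c.2.+1%:R^-1 `<=` A >] then
    h @^-1` ball (map_mx ratr c.1 : 'M[R]_(p, q)) c.2.+1%:R^-1 else set0.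
rewrite (_ : _ @^-1` _ = \bigcup_c F c).
  apply: countable_bigcupT_measurable => // c; rewrite /F.
  case: ifPn => // _.
  (* Balls are those of the sup norm, hence finite intersections of conditions on single entries. *)
  rewrite (_ : _ @^-1` _ = \bigcap_(ij in [set: 'I_p * 'I_q])
    ((fun t => h t ij.1 ij.2) @^-1` ball (ratr (c.1 ij.1 ij.2) : R) c.2.+1%:R^-1)).
    apply: fin_bigcap_measurable => // -[i j] _ /=.
    by rewrite -[X in measurable X]setTI; apply: mh => //; exact: measurable_ball.
  apply/seteqP; split => t /=.
    by move=> [_ ht] [i j] _ /=; have := ht i j; rewrite mxE.
  by move=> ht; split=> // i j; rewrite mxE; exact: (ht (i, j)).
apply/seteqP; split => t /=.
  move=> /(rat_ball_subset oA)[c [cA ct]]; exists c => //.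
  by rewrite /F asboolT.
by move=> [c _]; rewrite /F; case: asboolP => // cA /cA.
Qed.

End BorelMeasurability.

(** * Real sequences *)

Section RealSequences.
Context {R : realType}.
Implicit Types (u e : nat -> R).

Lemma nneseries_lty_bounded u p : (forall k, (p <= k)%N -> 0 <= u k) ->
  (\sum_(p <= k <oo) (u k)%:E < +oo)%E ->
  exists M, forall n, \sum_(p <= k < n) u k <= M.
Proof.
move=> u0 us; have u0' k : (p <= k)%N -> true -> (0 <= (u k)%:E)%E.
  by move=> pk _; rewrite lee_fin u0.
exists (fine (\sum_(p <= k <oo) (u k)%:E)%E) => n.
rewrite -lee_fin fineK; last by rewrite ge0_fin_numE// nneseries_ge0.
by rewrite -sumEFin; exact: nneseries_lim_ge.
Qed.

Lemma nneseries_le_bound u p M : (forall k, (p <= k)%N -> 0 <= u k) ->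
  (forall n, \sum_(p <= k < n) u k <= M) ->
  (\sum_(p <= k <oo) (u k)%:E <= M%:E)%E.
Proof.
move=> u0 uM; apply: lime_le.
  by apply: is_cvg_nneseries => k pk _; rewrite lee_fin u0.
by apply: nearW => n; rewrite sumEFin lee_fin.
Qed.

(** The shifted sequence [v] plus the partial sums [s] is nondecreasing and bounded by [v 0 + 2 M];
    [v] is then a difference of two convergent sequences. *)
Lemma cvgn_of_bounded_increments u e p M :
  (forall k, (p <= k)%N -> `|u k.+1 - u k| <= e k) ->
  (forall n, \sum_(p <= k < n) e k <= M) -> cvgn u.
Proof.
move=> ue eM.
have e0 k : (p <= k)%N -> 0 <= e k by move=> /ue; exact: le_trans.
pose s n := \sum_(p <= k < n + p) e k; pose v n := u (n + p)%N.
have sS n : s n.+1 = s n + e (n + p)%N by rewrite /s addSn big_nat_recr//= leq_addl.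
have s0 : s 0%N = 0 by rewrite /s add0n big_geq.
have cs : cvgn s.
  apply: nondecreasing_is_cvgn.
    by apply/nondecreasing_seqP => n; rewrite sS lerDl e0// leq_addl.
  by exists M => _ [n _ <-]; exact: eM.
have vE n : `|v n.+1 - v n| <= e (n + p)%N by rewrite /v addSn ue// leq_addl.
have ct : cvgn (v \+ s).
  apply: nondecreasing_is_cvgn.
    apply/nondecreasing_seqP => n /=; rewrite sS.
    by have := vE n; rewrite ler_norml => /andP[]; lra.
  exists (v 0%N + 2 * M) => _ [n _ <-] /=.
  suff : v n <= v 0%N + s n by have := eM (n + p)%N; rewrite -/(s n); lra.
  elim: n => [|n IH]; first by rewrite s0 addr0.
  by rewrite sS; have := vE n; rewrite ler_norml => /andP[_]; lra.
have : cvgn v.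
  have -> : v = (v \+ s) \- s by apply/funext => n /=; rewrite addrK.
  exact: is_cvgB.
by rewrite /v => /cvg_ex[l]; rewrite cvg_shiftn => ul; apply/cvg_ex; exists l.
Qed.

(* The increments of G ^+ 3 are summable, whereas those of G need not be. *)
Lemma cvg0_of_weighted_sums (a G N : nat -> R) (C A B : R) p :
  (forall k, (p <= k)%N -> 0 <= a k) -> (forall k, 0 <= G k) ->
  (forall k, 0 <= N k) -> 0 <= C ->
  (forall k, (p <= k)%N -> `|G k.+1 - G k| <= C * (a k * N k)) ->
  (forall M, exists n, M < \sum_(p <= k < n) a k) ->
  (forall n, \sum_(p <= k < n) a k * (G k ^+ 2 * (1 + N k ^+ 2)) <= A) ->
  (forall n, \sum_(p <= k < n) a k ^+ 2 * N k ^+ 2 <= B) ->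
  G @ \oo --> (0 : R).
Proof.
move=> a0 G0 N0 C0 GN adiv hA hB.
pose d k := C * (a k * N k).
have d0 k : (p <= k)%N -> 0 <= d k by move=> pk; rewrite !mulr_ge0// a0.
have B0 : 0 <= B by have := hB 0%N; rewrite big_geq.
have dB k : (p <= k)%N -> d k ^+ 2 <= C ^+ 2 * B.
  move=> pk; rewrite /d exprMn exprMn; apply: ler_wpM2l; first exact: sqr_ge0.
  apply: le_trans (hB k.+1); rewrite big_nat_recr//= lerDr.
  by rewrite big_nat; apply: sumr_ge0 => i _; rewrite mulr_ge0// sqr_ge0.
(* A uniform bound on [d k], by [2 t <= 1 + t ^+ 2]; it turns the cubes of [d k] into multiples of
   their summable squares. *)
pose D := 1 + C ^+ 2 * B.
have dD k : (p <= k)%N -> d k <= D.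
  by move=> /dB; rewrite /D; have := sqr_ge0 (d k - 1); nra.
(* With [h] the increment of [G], the factor [3 G^2 + 3 G h + h^2] is at most [5 G^2 + 5 d^2], since
   [2 G d <= G^2 + d^2]. Then [N <= 1 + N^2] handles [d G^2], and [d <= D] handles [d^3]. *)
pose e k := 5 * (C * (a k * (G k ^+ 2 * (1 + N k ^+ 2))) +
                 D * (C ^+ 2 * (a k ^+ 2 * N k ^+ 2))).
have D0 : 0 <= D by rewrite addr_ge0// mulr_ge0// sqr_ge0.
have cube k : (p <= k)%N -> `|G k.+1 ^+ 3 - G k ^+ 3| <= e k.
  move=> pk; set h := G k.+1 - G k.
  have hd : `|h| <= d k by exact: GN.
  have -> : G k.+1 ^+ 3 - G k ^+ 3 = h * (3 * G k ^+ 2 + 3 * G k * h + h ^+ 2).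
    by rewrite /h; ring.
  have dk := d0 k pk; have dDk := dD k pk.
  rewrite normrM; apply: (@le_trans _ _ (d k * (5 * G k ^+ 2 + 5 * d k ^+ 2))).
    apply: ler_pM => //.
    apply: le_trans (ler_normD _ _) _.
    have h1 : `|3 * G k ^+ 2 + 3 * G k * h| <= 3 * G k ^+ 2 + 3 * G k * d k.
      apply: le_trans (ler_normD _ _) _; apply: lerD.
        by rewrite ger0_norm// mulr_ge0// sqr_ge0.
      have Gk3 : 0 <= 3 * G k by rewrite mulr_ge0.
      by rewrite normrM (ger0_norm Gk3) ler_wpM2l.
    have h2 : `|h ^+ 2| <= d k ^+ 2.
      by rewrite normrX ler_sqr// nnegrE.
    have h3 : 0 <= (G k - d k) ^+ 2 by exact: sqr_ge0.
    have h4 : 0 <= d k ^+ 2 by exact: sqr_ge0.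
    have h5 : 0 <= G k ^+ 2 by exact: sqr_ge0.
    by nra.
  have e1 : d k * G k ^+ 2 <= C * (a k * (G k ^+ 2 * (1 + N k ^+ 2))).
    rewrite /d -(mulrA C) -(mulrA (a k)); apply: ler_wpM2l => //.
    apply: ler_wpM2l; first exact: a0.
    rewrite (mulrC (N k)); apply: ler_wpM2l; first exact: sqr_ge0.
    by have := sqr_ge0 (N k - 1); nra.
  have e2 : d k * d k ^+ 2 <= D * (C ^+ 2 * (a k ^+ 2 * N k ^+ 2)).
    have -> : C ^+ 2 * (a k ^+ 2 * N k ^+ 2) = d k ^+ 2 by rewrite /d; ring.
    by rewrite ler_wpM2r// sqr_ge0.
  by rewrite /e; lra.
have eM n : \sum_(p <= k < n) e k <= 5 * (C * A + D * (C ^+ 2 * B)).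
  rewrite /e -mulr_sumr; apply: ler_wpM2l => //.
  rewrite big_split/= -!mulr_sumr; apply: lerD; apply: ler_wpM2l => //.
  by rewrite ler_wpM2l// sqr_ge0.
have /cvg_ex[l Gl] := cvgn_of_bounded_increments cube eM.
have l0 : l = 0.
  apply/eqP; apply/negPn/negP => lN0.
  have lp : 0 < l.
    rewrite lt_neqAle eq_sym lN0/=; apply: cvgr_to_ge Gl _.
    by apply: nearW => k; rewrite exprn_ge0.
  have l2 : l / 2 < l by rewrite ltr_pdivrMr// mulr_natr mulr2n ltrDl.
  have [K _ KG] := cvgr_gt _ Gl _ l2.
  (* No cube root is taken: beyond [K], either [G k >= 1], or [G k < 1] and then
     [G k >= G k ^+ 3 > l / 2]. *)
  pose c := Num.min 1 (l / 2).
  have c0 : 0 < c by rewrite lt_min ltr01 divr_gt0.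
  have cG k : (K <= k)%N -> c <= G k.
    move=> /KG/= lG; have [G1|G1] := leP 1 (G k).
      by rewrite ge_min G1.
    rewrite ge_min; apply/orP; right; apply: le_trans (ltW lG) _.
    rewrite exprS ler_piMr// expr2.
    by rewrite mulr_ile1// ltW.
  pose S := \sum_(p <= k < K) a k.
  have [n] := adiv (S + A / c ^+ 2).
  apply/negP; rewrite -leNgt.
  have A0 : 0 <= A by have := hA 0%N; rewrite big_geq.
  (* Terms before [K] are kept as they are; from [K] on, [G k >= c] bounds [a k] by the weighted
     term over [c ^+ 2]. The total [S + A / c ^+ 2] contradicts divergence. *)
  have : \sum_(p <= k < n) a k <=
      \sum_(p <= k < n) ((if (k < K)%N then a k else 0) +
        a k * (G k ^+ 2 * (1 + N k ^+ 2)) / c ^+ 2).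
    rewrite big_nat [leRHS]big_nat; apply: ler_sum => k /andP[pk kn].
    have t0 : 0 <= a k * (G k ^+ 2 * (1 + N k ^+ 2)) / c ^+ 2.
      apply: mulr_ge0; last by rewrite invr_ge0 sqr_ge0.
      by rewrite mulr_ge0 ?a0// mulr_ge0 ?sqr_ge0// addr_ge0// sqr_ge0.
    case: ltnP => [kK|Kk]; first by rewrite lerDl.
    rewrite add0r -mulrA ler_peMr ?a0// ler_pdivlMr ?exprn_gt0// mul1r.
    have := cG k Kk; have := sqr_ge0 (N k) => h1 h2.
    have h3 : c ^+ 2 <= G k ^+ 2 by rewrite ler_sqr ?nnegrE ?G0// ltW.
    have := sqr_ge0 (G k); nra.
  move=> /le_trans; apply; rewrite big_split/= -mulr_suml; apply: lerD; last first.
    by rewrite ler_wpM2r// invr_ge0 sqr_ge0.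
  (* Both sums are extended to the common range up to [maxn n K], where they compare term by
     term. *)
  rewrite -big_mkcond /S/= (@big_nat_widen _ _ _ _ _ (maxn n K)) ?leq_maxl//.
  rewrite [leRHS](@big_nat_widen _ _ _ _ _ (maxn n K)) ?leq_maxr//.
  rewrite big_nat_cond big_mkcond [leRHS]big_nat_cond [leRHS]big_mkcond.
  apply: ler_sum => k _ /=; case: ifP => [/andP[pkn /andP[kK _]]|_].
    by rewrite pkn kK.
  by case: ifP => // /andP[/andP[pk _] _]; rewrite a0.
apply/cvgr0Pnorm_lt => eps eps0.
move: Gl; rewrite l0 => /cvgr0Pnorm_lt/(_ (eps ^+ 3) (exprn_gt0 _ eps0)).
apply: filterS => k; rewrite normrX.
by rewrite ltr_pXn2r ?nnegrE ?normr_ge0 ?(ltW eps0).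
Qed.

End RealSequences.

(** * Independence *)

Section Independence.
Context {d dS : measure_display} {Omega : measurableType d}
  {S : measurableType dS} {R : realType} (P : probability Omega R).

(** A pi-system generating [sigma_generated D X], on which mutual independence is directly a product
    formula. *)
Definition cylinder (I : choiceType) (D : set I) (X : I -> Omega -> S)
  : set (set Omega) :=
  [set A | exists (J : {fset I}) (B : I -> set S),
    [/\ [set` J] `<=` D, forall i, measurable (B i) &
        A = \bigcap_(i in [set` J]) (X i @^-1` B i)]].

Lemma cylinder_setI (I : choiceType) (D : set I) (X : I -> Omega -> S) :
  setI_closed (cylinder D X).
Proof.
move=> _ _ [J [B [JD mB ->]]] [K [C [KD mC ->]]].
exists (J `|` K)%fset, (fun i => (if i \in J then B i else setT) `&`
  (if i \in K then C i else setT)); split.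
- by move=> i /=; rewrite in_fsetU => /orP[/JD|/KD].
- by move=> i; apply: measurableI; case: ifP.
apply/seteqP; split=> [w [wB wC] i /=|w wBC].
  by rewrite in_fsetU => _; split; case: ifP => // iX; [exact: wB|exact: wC].
split=> i /= iX; have := wBC i; rewrite /= in_fsetU iX ?orbT => /(_ isT)[].
  by [].
by [].
Qed.

Lemma cylinder_measurable (I : choiceType) (D : set I) (X : I -> Omega -> S) :
  (forall i, D i -> measurable_fun setT (X i)) ->
  cylinder D X `<=` measurable.
Proof.
move=> mX _ [J [B [JD mB ->]]]; apply: fin_bigcap_measurable => // i iJ.
by rewrite -[X in measurable X]setTI; apply: mX => //; exact: JD.
Qed.

Lemma sigma_generated_cylinder (I : choiceType) (D : set I)
    (X : I -> Omega -> S) :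
  sigma_generated D X `<=` <<s cylinder D X >>.
Proof.
apply: smallest_sub; first exact: smallest_sigma_algebra.
move=> _ [i Di [B mB <-]]; apply: sub_sigma_algebra.
exists [fset i]%fset, (fun=> B); split=> //.
  by move=> j /=; rewrite in_fset1 => /eqP ->.
rewrite setTI; apply/seteqP; split=> [w wB j /=|w].
  by rewrite in_fset1 => /eqP ->.
by apply; rewrite /= in_fset1.
Qed.

Lemma sigma_generated_measurable (I : Type) (D : set I) (X : I -> Omega -> S) :
  (forall i, D i -> measurable_fun setT (X i)) ->
  sigma_generated D X `<=` measurable.
Proof.
move=> mX; apply: smallest_sub; first exact: sigma_algebra_measurable.
by move=> _ [i Di [B mB <-]]; exact: mX.
Qed.

(** As functions of [A], the two sides are finite measures: [P] restricted to [E], and [P] scaled by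
    [P E]. They agree on the cylinders over [D0], hence on the sigma-algebra these generate. *)
Lemma mutually_independent_sigma (I : choiceType) (D D0 : set I) (j : I)
    (X : I -> Omega -> S) (A : set Omega) (B : set S) :
  mutually_independent P D X -> (forall i, D i -> measurable_fun setT (X i)) ->
  D0 `<=` D -> D j -> ~ D0 j -> sigma_generated D0 X A -> measurable B ->
  (P (A `&` X j @^-1` B) = P A * P (X j @^-1` B))%E.
Proof.
move=> ind mX D0D Dj D0j sA mB; set E := X j @^-1` B.
have mE : measurable E by rewrite -[E]setTI; exact: mX.
have pE0 : 0 <= fine (P E) by rewrite fine_ge0.
suff : mrestr P mE A = mscale (NngNum pE0) P A.
  by rewrite /mrestr /mscale/= fineK ?fin_num_measure// muleC.
have mX0 i : D0 i -> measurable_fun setT (X i) by move=> /D0D; exact: mX.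
apply: (g_sigma_algebra_measure_unique (cylinder D0 X) _ (fun=> setT)).
- exact: cylinder_measurable.
- move=> _; exists fset0, (fun=> setT); split => //.
  by apply/seteqP; split=> // w _ i.
- by rewrite bigcup_const.
- exact: cylinder_setI.
- move=> _ [J [C [JD0 mC ->]]].
  rewrite /= /mrestr /mscale/= fineK ?fin_num_measure//.
  have jJ : j \notin J by apply/negP => /JD0.
  (* Since [j] is outside [J], placing [B] at index [j] makes the intersection with [E] a single
     cylinder. *)
  pose C' i := if i == j then B else C i.
  have mC' i : measurable (C' i) by rewrite /C'; case: ifP.
  have C'J i : i \in J -> C' i = C i.
    by rewrite /C'; case: eqVneq => // ->; rewrite (negbTE jJ).
  have -> : \bigcap_(i in [set` J]) X i @^-1` C i `&` E =
      \bigcap_(i in [set` (j |` J)%fset]) X i @^-1` C' i.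
    rewrite bigcap_fsetU1 setIC /C' eqxx; congr (_ `&` _).
    by apply: eq_bigcapr => i /= /C'J; rewrite /C' => ->.
  rewrite ind//; last first.
    by move=> i /=; rewrite in_fset1U => /orP[/eqP ->//|/JD0/D0D].
  rewrite big_fsetU1//= {1}/C' eqxx; congr (_ * _)%E.
  rewrite ind//; last by move=> i /JD0/D0D.
  by rewrite big_seq [RHS]big_seq; apply: eq_bigr => i /C'J ->.
- by move=> _; rewrite /= /mrestr setTI (le_lt_trans (probability_le1 P mE))// ltry.
- exact: sigma_generated_cylinder.
Qed.

End Independence.

(** * Integrating out one of two independent variables *)

Section Freezing.
Context {d d1 d2 : measure_display} {Omega : measurableType d}
  {T1 : measurableType d1} {T2 : measurableType d2} {R : realType}
  (P : probability Omega R).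
Variables (X : Omega -> T1) (Y : Omega -> T2) (h : T1 * T2 -> \bar R).
Hypotheses (mX : measurable_fun setT X) (mY : measurable_fun setT Y).
Hypotheses (mh : measurable_fun setT h) (h0 : forall z, (0 <= h z)%E).

Let mX_mixin := isMeasurableFun.Build _ _ _ _ _ mX.
Let X' : {mfun Omega >-> T1} := HB.pack X mX_mixin.
Let mY_mixin := isMeasurableFun.Build _ _ _ _ _ mY.
Let Y' : {mfun Omega >-> T2} := HB.pack Y mY_mixin.

Let frozenE w : (\int[distribution P Y']_y h (X w, y) =
  \int[P]_w' h (X w, Y w'))%E.
Proof.
rewrite ge0_integral_distribution//.
exact: measurable_fun_pair2.
Qed.

Lemma measurable_frozen_integral :
  measurable_fun setT (fun w => (\int[P]_w' h (X w, Y w'))%E).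
Proof.
under eq_fun do rewrite -frozenE.
apply: (@measurableT_comp _ _ _ _ _ _
  (fubini_F (distribution P Y') h) setT X) => //.
exact: measurable_fun_fubini_tonelli_F.
Qed.

(* The inner integral, with X w held fixed, is the conditional expectation of
   h (X, Y) given X. *)
Lemma integral_frozen :
  (forall A B, measurable A -> measurable B ->
    P (X @^-1` A `&` Y @^-1` B) = P (X @^-1` A) * P (Y @^-1` B))%E ->
  (\int[P]_w h (X w, Y w) = \int[P]_w \int[P]_w' h (X w, Y w'))%E.
Proof.
move=> ind.
have mXY : measurable_fun setT (fun w => (X w, Y w)).
  exact: measurable_fun_pair.
pose XY_mixin := isMeasurableFun.Build _ _ _ _ _ mXY.
pose XY : {mfun Omega >-> (T1 * T2)%type} := HB.pack (fun w => (X w, Y w)) XY_mixin.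
transitivity (\int[distribution P XY]_z h z)%E.
  by rewrite ge0_integral_distribution.
(* Independence on rectangles identifies the joint law with the product of the marginal laws. *)
transitivity (\int[distribution P X' \x distribution P Y']_z h z)%E.
  apply: eq_measure_integral => A mA _; apply/esym.
  apply: product_measure_unique => //.

rewrite fubini_tonelli1//.
rewrite ge0_integral_distribution//; last 2 first.
- exact: measurable_fun_fubini_tonelli_F.
- by move=> y; apply: integral_ge0.
by apply: eq_integral => w _; rewrite /= /fubini_F frozenE.
Qed.

End Freezing.

(** * Moments *)

Section FirstMoments.
Context {dO : measure_display} {Omega : measurableType dO} {R : realType}
  (P : probability Omega R) {n : nat}.
Variables (Z : Omega -> 'cV[R]_n) (v : 'cV[R]_n) (Mg : R).
Hypothesis mZ : forall j, measurable_fun setT (fun w => Z w j 0).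
Hypothesis EZ : forall j, ('E_P[fun w => Z w j 0%R] = (v j 0%R)%:E)%E.
Hypothesis EZ2 : (\int[P]_w (dot (Z w) (Z w))%:E <= Mg%:E)%E.

Let q w := dot (Z w) (Z w).

Let mq : measurable_fun setT q.
Proof. by apply: measurable_sum => j; exact: measurable_funM. Qed.

Let iq : P.-integrable setT (EFin \o q).
Proof.
apply/integrableP; split; first exact/measurable_EFinP.
apply: le_lt_trans (ltry Mg); apply: le_trans EZ2.
rewrite le_eqVlt; apply/orP; left; apply/eqP; apply: eq_integral => w _ /=.
by rewrite ger0_norm// dot_ge0.
Qed.

Let iZ j : P.-integrable setT (EFin \o (fun w => Z w j 0)).
Proof.
(* Each coordinate is dominated through [|t| <= 1 + t ^+ 2]; constants are integrable for a
   probability. *)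
apply: (@le_integrable _ _ _ _ _ measurableT _ (cst 1%:E \+ (EFin \o q))%E).
- exact/measurable_EFinP.
- move=> w _ /=; rewrite lee_fin [leRHS]ger0_norm ?addr_ge0 ?dot_ge0//.
  have : Z w j 0 ^+ 2 <= q w.
    by rewrite /q /dot (bigD1 j)//= expr2 lerDl sumr_ge0// => i _; rewrite -expr2 sqr_ge0.
  by rewrite ler_norml; have := sqr_ge0 (Z w j 0 - 1); have := sqr_ge0 (Z w j 0 + 1); nra.
- apply: integrableD => //; exact: finite_measure_integrable_cst.
Qed.

Let iZu (u : 'cV[R]_n) : P.-integrable setT (EFin \o (fun w => dot u (Z w))).
Proof.
rewrite (_ : EFin \o _ = fun w => \sum_j ((u j 0)%:E * (Z w j 0)%:E))%E.
  by apply: integrable_sum => // j _; exact: (integrableZl measurableT (u j 0) (iZ j)).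
by apply/funext => w; rewrite /= sumEFin.
Qed.

Let EZu (u : 'cV[R]_n) : (\int[P]_w (dot u (Z w))%:E = (dot u v)%:E)%E.
Proof.
under eq_integral => w _ do rewrite /dot -sumEFin.
rewrite integral_sum//; last by move=> j; exact: (integrableZl measurableT (u j 0) (iZ j)).
rewrite /dot -sumEFin; apply: eq_bigr => j _.
under eq_integral => w _ do rewrite EFinM.
rewrite (integralZl measurableT (iZ j)) EFinM; congr (_ * _)%E.
by have := EZ j; rewrite unlock.
Qed.

(** Serves the descent estimate with the past frozen: the affine part integrates through the mean,
    the quadratic part through the second moment. Nonnegativity of [h] allows comparison by
    monotonicity alone. *)
Lemma integral_affine_quadratic_le (h : Omega -> R) (c b : R) (u : 'cV[R]_n) :
  measurable_fun setT h -> 0 <= b ->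
  (forall w, 0 <= h w <= c + dot u (Z w) + b * dot (Z w) (Z w)) ->
  (\int[P]_w (h w)%:E <= (c + dot u v + b * Mg)%:E)%E.
Proof.
move=> mh b0 hU.
have mdot : measurable_fun setT (fun w => dot u (Z w)).
  by apply: measurable_sum => j; exact: measurable_funM.
apply: (@le_trans _ _ (\int[P]_w (c + dot u (Z w) + b * q w)%:E)%E).
  apply: ge0_le_integral => //.
  - by move=> w _; rewrite lee_fin; have /andP[] := hU w.
  - exact/measurable_EFinP.
  - apply/measurable_EFinP/measurable_funD; last exact: measurable_funM.
    exact: measurable_funD.
  - by move=> w _; rewrite lee_fin; have /andP[] := hU w.
have ic : P.-integrable setT (cst c%:E) by exact: finite_measure_integrable_cst.
under eq_integral => w _ do rewrite EFinD EFinD EFinM.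
rewrite (integralD measurableT (integrableD measurableT ic (iZu u))
  (integrableZl measurableT b iq)).
rewrite (integralD measurableT ic (iZu u))/=.
have := expectation_cst P c; rewrite unlock => ->.
rewrite EZu (integralZl measurableT iq).
by rewrite EFinD EFinD leeD2l// EFinM lee_wpmul2l// lee_fin.
Qed.

End FirstMoments.

(** * Averages over a batch of samples *)

Section AverageOfSamples.
Context {d d1 d2 : measure_display} {Omega : measurableType d}
  {T1 : measurableType d1} {T2 : measurableType d2} {R : realType}
  (P : probability Omega R) (m : nat).
Variables (X : Omega -> T1) (Y : 'I_m -> Omega -> T2) (h : T1 * T2 -> R)
  (b : Omega -> R).
Hypotheses (m0 : (0 < m)%N) (mX : measurable_fun setT X)
  (mY : forall i, measurable_fun setT (Y i)).
Hypothesis indep : forall i A B, measurable A -> measurable B ->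
  (P (X @^-1` A `&` Y i @^-1` B) = P (X @^-1` A) * P (Y i @^-1` B))%E.
Hypotheses (mh : measurable_fun setT h) (h0 : forall z, 0 <= h z).
Hypotheses (mb : measurable_fun setT b) (b0 : forall w, 0 <= b w).
Hypothesis hb : forall i, {ae P, forall w,
  (\int[P]_w' (h (X w, Y i w'))%:E <= (b w)%:E)%E}.

(** Freezing is applied to one sample at a time, each being independent of [X]; the [m] equal bounds
    then average back to one. *)
Lemma integral_average_frozen_le :
  (\int[P]_w (m%:R^-1 * \sum_(i < m) h (X w, Y i w))%:E <=
   \int[P]_w (b w)%:E)%E.
Proof.
have mEh : measurable_fun setT (EFin \o h) by exact/measurable_EFinP.
have Eh0 z : (0 <= (EFin \o h) z)%E by rewrite lee_fin.
have mhY i : measurable_fun setT (fun w => h (X w, Y i w)).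
  by apply: measurableT_comp => //; exact: measurable_fun_pair.
have le1 i : (\int[P]_w (h (X w, Y i w))%:E <= \int[P]_w (b w)%:E)%E.
  rewrite (integral_frozen mX (mY i) mEh Eh0 (indep i)).
  apply: ae_ge0_le_integral => //.
  - by move=> w _; apply: integral_ge0.
  - exact: measurable_frozen_integral.
  - by move=> w _; rewrite lee_fin.
  - exact/measurable_EFinP.
  - by apply: filterS (hb i) => w hw _.
under eq_integral => w _ do rewrite EFinM -sumEFin.
rewrite ge0_integralZl_EFin//; first last.
- apply: emeasurable_sum => i; exact/measurable_EFinP.
- by move=> w _; apply: sume_ge0 => i _; rewrite lee_fin.
rewrite ge0_integral_sum//; first last.
- by move=> i w _; rewrite lee_fin.
- by move=> i; exact/measurable_EFinP.
have mR : m%:R != 0 :> R by rewrite pnatr_eq0 -lt0n.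
apply: (@le_trans _ _ (m%:R^-1%:E * \sum_(i < m) \int[P]_w (b w)%:E)%E).
  by apply: lee_wpmul2l; [rewrite lee_fin|exact: lee_sum].
(* The integral of [b] may be infinite, so equal terms are added in the extended reals. *)
have -> N (a : \bar R) : (\sum_(i < N) a = N%:R%:E * a)%E.
  elim: N => [|N IH]; first by rewrite big_ord0 mul0e.
  by rewrite big_ord_recr/= IH -natr1 EFinD ge0_muleDl ?lee_fin// mul1e.
by rewrite muleA -EFinM mulVf// mul1e.
Qed.

End AverageOfSamples.

(** Monotone convergence exchanges sum and integral; the series has a finite integral, so it is
    finite almost everywhere. *)
Lemma ae_bounded_partial_sums {d} {Omega : measurableType d} {R : realType}
    (P : probability Omega R) (u : nat -> Omega -> R) (M : R) :
  (forall k, measurable_fun setT (u k)) -> (forall k w, 0 <= u k w) ->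
  (forall N, \sum_(0 <= k < N) \int[P]_w (u k w)%:E <= M%:E)%E ->
  {ae P, forall w, exists B, forall N, \sum_(0 <= k < N) u k w <= B}.
Proof.
move=> mu u0 uM.
have u0' k w : setT w -> (0 <= (u k w)%:E)%E by rewrite lee_fin.
have mu' k : measurable_fun setT (fun w => (u k w)%:E) by exact/measurable_EFinP.
have iS : P.-integrable setT (fun w => \sum_(0 <= k <oo) (u k w)%:E)%E.
  apply/integrableP; split.
    by apply: ge0_emeasurable_sum => // k w Dw _; exact: u0'.
  have -> : (\int[P]_w `|\sum_(0 <= k <oo) (u k w)%:E| =
      \int[P]_w \sum_(0 <= k <oo) (u k w)%:E)%E.
    apply: eq_integral => w _.
    by rewrite gee0_abs// nneseries_ge0// => k _ _; rewrite lee_fin.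
  rewrite integral_nneseries//; apply: le_lt_trans (ltry M).
  apply: lime_le; last by apply: nearW => N; exact: uM.
  by apply: is_cvg_nneseries => k _ _; apply: integral_ge0 => w; exact: u0'.
apply: filterS (integrable_ae measurableT iS) => w /(_ I) fw.
apply: (@nneseries_lty_bounded R (fun k => u k w) 0%N) => //.
by rewrite -ge0_fin_numE// nneseries_ge0// => k _ _; rewrite lee_fin.
Qed.

(** * The stochastic quasi-Newton iteration *)

Section SQN.
Context {dO : measure_display} {Omega : measurableType dO} {R : realType}
  (P : probability Omega R) (n d : nat).
Variables (Xi : set 'cV[R]_d) (f : 'cV[R]_n -> R)
  (g : 'cV[R]_n -> 'cV[R]_d -> 'cV[R]_n)
  (m_ : nat -> nat) (m : nat) (xi : nat * nat -> Omega -> 'cV[R]_d)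
  (alpha : nat -> R) (x1 : 'cV[R]_n) (H1 : 'M[R]_n)
  (H : nat -> Omega -> 'M[R]_n) (x : nat -> Omega -> 'cV[R]_n)
  (L flow sigma kl ku Mg : R).
Hypotheses (oracle : stochastic_oracle P Xi g m_ xi)
  (iteration : sqn_iteration g m_ xi alpha x1 H1 H x)
  (AS1 : smooth_bounded_below f L flow)
  (AS2 : unbiased_bounded_variance P f g m_ xi x sigma)
  (AS3 : uniformly_definite P H kl ku)
  (AS4 : past_dependent m_ xi H)
  (batch_constant : forall k, (0 < k)%N -> m_ k = m)
  (second_moment : bounded_second_moment P g m_ xi x Mg).

(** Generators of [sigma_generated (past_index m_ k) xi]. As a set system they make [past k] a
    measurable type, and [id : Omega -> past k] then serves as the variable conditioned upon. *)
Definition past_cylinders k : set (set Omega) :=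
  \bigcup_(p in past_index m_ k)
    preimage_set_system setT (xi p : Omega -> Borel 'cV[R]_d) measurable.

(* Omega equipped with the sigma-algebra of the samples drawn before iteration k. *)
Notation past k := (g_sigma_algebraType (past_cylinders k)).

(** * Measurability of the iterates with respect to the past *)

Lemma measurable_past_mono d' (T : measurableType d') (h : Omega -> T) k k' :
  (k <= k')%N -> measurable_fun setT (h : past k -> T) ->
  measurable_fun setT (h : past k' -> T).
Proof.
move=> kk' mh _ B mB; have := mh measurableT B mB.
apply: sub_sigma_algebra2 => _ [p [p0 pk pm] [C mC <-]].
by exists p; [split=> //; exact: leq_trans pk kk'|exists C].
Qed.

Lemma measurable_past_id k : measurable_fun setT (id : Omega -> past k).
Proof.
move=> _ B mB; rewrite setTI preimage_id.
apply: sigma_generated_measurable mB => p [p0 _ pm].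
exact: (sample_measurable oracle).
Qed.

Lemma measurable_past d' (T : measurableType d') (h : Omega -> T) k :
  measurable_fun setT (h : past k -> T) -> measurable_fun setT h.
Proof.
move=> mh.
exact: (@measurableT_comp _ _ _ Omega (past k) T h setT id mh
  (@measurable_past_id k)).
Qed.

Lemma measurable_past_sample k p : past_index m_ k p ->
  measurable_fun setT (xi p : past k -> Borel 'cV[R]_d).
Proof. by move=> kp _ B mB; apply: sub_sigma_algebra; exists p => //; exists B. Qed.

Lemma measurable_past_H k i j : (0 < k)%N ->
  measurable_fun setT ((fun w => H k w i j) : past k -> R).
Proof.
case: k => [//|[_|k _]].
  (* [AS4] starts at iteration 2; the first matrix is deterministic. *)
  by under eq_fun do rewrite (sqn_H1 iteration); exact: measurable_cst.
apply: (@measurableT_comp _ _ _ _ _ _ ((fun A => A i j) : Borel 'M[R]_n -> R)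
  setT (H k.+2 : past k.+2 -> Borel 'M[R]_n)); first exact: measurable_coord.
by move=> _ B mB; rewrite setTI; exact: AS4.
Qed.

(** Adaptedness, by induction: [x k.+1] is built from [x k], [H k] and the samples of iteration [k],
    which belong to the past of [k.+1]. *)
Lemma measurable_past_x k : (0 < k)%N ->
  measurable_fun setT (x k : past k -> Borel 'cV[R]_n).
Proof.
elim: k => // -[_ _|k /(_ isT) IH _].
  rewrite (_ : x 1%N = cst x1); first exact: measurable_cst.
  by apply/funext => w; rewrite (sqn_x1 iteration).
have mxS := measurable_past_mono (leqnSn _) IH.
apply: measurable_fun_Borel_mx => i j; rewrite (ord1 j).
under eq_fun do rewrite (sqn_next iteration)// !mxE.
apply: measurable_funB.
  exact: (measurableT_comp (measurable_coord i 0) mxS).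
apply: measurable_funM => //; apply: measurable_sum => l.
apply: measurable_funM.
  by apply: measurable_past_mono (leqnSn _) _; exact: measurable_past_H.
rewrite /batch_gradient; under eq_fun do rewrite mxE summxE.
apply: measurable_funM => //; apply: measurable_sum => s.
apply: (measurableT_comp (measurable_coord l 0)).
apply: (@measurableT_comp _ _ _ (past k.+2)
  (Borel 'cV[R]_n * Borel 'cV[R]_d)%type (Borel 'cV[R]_n) (fun p => g p.1 p.2)
  setT (fun w => (x k.+1 w, xi (k.+1, val s) w)) (oracle_measurable oracle)).
apply: measurable_fun_pair => //.
by apply: measurable_past_sample; split=> //=; rewrite ltn_ord.
Qed.

Lemma measurable_past_oracle k j : (0 < k)%N ->
  measurable_fun setT
    ((fun p => g (x k p.1) p.2 j 0) : (past k * Borel 'cV[R]_d)%type -> R).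
Proof.
move=> k0; apply: (measurableT_comp (measurable_coord j 0)).
apply: (@measurableT_comp _ _ _ (past k * Borel 'cV[R]_d)%type
  (Borel 'cV[R]_n * Borel 'cV[R]_d)%type (Borel 'cV[R]_n) (fun p => g p.1 p.2)
  setT (fun p => (x k p.1, p.2)) (oracle_measurable oracle)).
apply: measurable_fun_pair; last exact: measurable_snd.
exact: measurableT_comp (measurable_past_x k0) measurable_fst.
Qed.

(** Independence in the form that [integral_frozen] asks for, with [X := id]. It follows from mutual
    independence of the samples, as [(k, i)] is outside [past_index m_ k]. *)
Lemma past_sample_indep k i (A : set (past k)) (B : set (Borel 'cV[R]_d)) :
  (0 < k)%N -> (i < m)%N -> measurable A -> measurable B ->
  (P (id @^-1` A `&` xi (k, i) @^-1` B) =
   P (id @^-1` A) * P (xi (k, i) @^-1` B))%E.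
Proof.
move=> k0 im mA mB; rewrite preimage_id.
apply: (mutually_independent_sigma (ubv_samples AS2)
  (D0 := past_index m_ k)) => //.
- exact: (sample_measurable oracle).
- by move=> p [p0 _ pm].
- by split=> //=; rewrite batch_constant.
- by move=> [_] /=; rewrite ltnn.
Qed.

(** * One-step descent of the objective *)

Notation sqgrad k w := (dot (grad f (x k w)) (grad f (x k w))).
Notation smp k w z := (g (x k w) z).

Let f_diff y : differentiable f y.
Proof. exact: (sbb_C1 AS1).1. Qed.

Lemma measurable_past_f k : (0 < k)%N ->
  measurable_fun setT ((fun w => f (x k w)) : past k -> R).
Proof.
move=> k0; apply: (@measurableT_comp _ _ _ (past k) (Borel 'cV[R]_n) R f setT
  (x k)); last exact: measurable_past_x.
by apply: continuous_Borel_measurable => y; exact: differentiable_continuous.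
Qed.

Lemma measurable_past_grad k j : (0 < k)%N ->
  measurable_fun setT ((fun w => grad f (x k w) j 0) : past k -> R).
Proof.
move=> k0; under eq_fun do rewrite mxE.
apply: (@measurableT_comp _ _ _ (past k) (Borel 'cV[R]_n) R
  (fun y => 'D_(delta_mx j 0) f y) setT (x k)); last exact: measurable_past_x.
by apply: continuous_Borel_measurable; exact: (sbb_C1 AS1).2.
Qed.

Lemma measurable_past_sqgrad k : (0 < k)%N ->
  measurable_fun setT ((fun w => sqgrad k w) : past k -> R).
Proof.
move=> k0; apply: measurable_sum => j.
by apply: measurable_funM; exact: measurable_past_grad.
Qed.

(* Nonnegative for every z, so that conditioning on the past only requires
   Tonelli's theorem, and convex in the sampled gradient, so that a batch is
   handled one sample at a time. *)
Definition descent_bound k (w : Omega) z : R :=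
  f (x k w) - flow - alpha k * dot (grad f (x k w)) (H k w *m smp k w z) +
  alpha k ^+ 2 * L * dot (H k w *m smp k w z) (H k w *m smp k w z).

Let L0 : 0 <= L. Proof. exact: ltW (sbb_L_gt0 AS1). Qed.

(** By the Taylor estimate it dominates the gap [f - flow] at the point reached with the single
    gradient [g (x k w) z]. *)
Lemma descent_bound_ge0 k w z : 0 <= descent_bound k w z.
Proof.
have := le_taylor_lipschitz_grad (x k w) (- (alpha k *: (H k w *m smp k w z)))
  f_diff L0 (sbb_lipschitz AS1).
have := sbb_lower AS1 (x k w - alpha k *: (H k w *m smp k w z)).
by rewrite /descent_bound !(dotNr, dotNl, dotZr, dotZl); lra.
Qed.

Let m_gt0 : (0 < m)%N.
Proof. by rewrite -(batch_constant (ltn0Sn 0)) (sqn_batch iteration). Qed.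

Let mR_gt0 : 0 < m%:R :> R. Proof. by rewrite ltr0n. Qed.

Let mean_cst (c : R) : m%:R^-1 * (c *+ m) = c.
Proof. by rewrite -[c *+ m]mulr_natl mulKf ?gt_eqF. Qed.

Let batchE k w : (0 < k)%N -> batch_gradient g m_ xi x k w =
  m%:R^-1 *: \sum_(i < m) smp k w (xi (k, val i) w).
Proof. by move=> k0; rewrite /batch_gradient batch_constant. Qed.

(** In the Taylor estimate for the batch step, the linear term averages exactly and the quadratic
    one by convexity ([sqr_enorm_mean]). *)
Lemma next_le_average_descent_bound k w : (0 < k)%N ->
  f (x k.+1 w) - flow <=
  m%:R^-1 * \sum_(i < m) descent_bound k w (xi (k, val i) w).
Proof.
move=> k0; rewrite (sqn_next iteration)// batchE//.
set v := fun i : 'I_m => H k w *m smp k w (xi (k, val i) w).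
have -> : H k w *m (m%:R^-1 *: \sum_(i < m) smp k w (xi (k, val i) w)) =
    m%:R^-1 *: \sum_i v i by rewrite -scalemxAr mulmx_sumr.
have h1 := le_taylor_lipschitz_grad (x k w)
  (- (alpha k *: (m%:R^-1 *: \sum_i v i))) f_diff L0 (sbb_lipschitz AS1).
have h2 := sqr_enorm_mean v m_gt0.
rewrite !(dotNl, dotNr, dotZl (alpha k), dotZr (alpha k)) opprK in h1.
have h3 : alpha k ^+ 2 * L * dot (m%:R^-1 *: \sum_i v i) (m%:R^-1 *: \sum_i v i)
    <= alpha k ^+ 2 * L * (m%:R^-1 * \sum_i dot (v i) (v i)).
  by rewrite ler_wpM2l// mulr_ge0// sqr_ge0.
rewrite /descent_bound !big_split/= !sumrN -!mulr_sumr !sumr_const card_ord.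
rewrite [dot (grad _ _) (_ *: _)]dotZr dot_sumr in h1.
rewrite !mulrDr !mulrN !mean_cst; move: h1 h3; rewrite /v; lra.
Qed.

Let kl_gt0 : 0 < kl. Proof. exact: ud_kl_gt0 AS3. Qed.
Let ku_gt0 : 0 < ku. Proof. exact: ud_ku_gt0 AS3. Qed.
Let Mg_gt0 : 0 < Mg. Proof. exact: second_moment.1. Qed.
Let alpha_gt0 k : (0 < k)%N -> 0 < alpha k.
Proof. exact: (sqn_step iteration). Qed.

Let noise_ge0 : 0 <= L * ku ^+ 2 * Mg.
Proof. by apply: mulr_ge0 (ltW Mg_gt0); apply: mulr_ge0 L0 (sqr_ge0 _). Qed.

Lemma measurable_sample i k : (0 < k)%N -> (i < m)%N ->
  measurable_fun setT (xi (k, i) : Omega -> Borel 'cV[R]_d).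
Proof.
by move=> k0 im; apply: (sample_measurable oracle); split=> //=; rewrite batch_constant.
Qed.

Lemma measurable_frozen_oracle k i w j : (0 < k)%N -> (i < m)%N ->
  measurable_fun setT (fun w' => smp k w (xi (k, i) w') j 0).
Proof.
move=> k0 im.
apply: (@measurableT_comp _ _ _ _ _ _
  (fun z : Borel 'cV[R]_d => smp k w z j 0) setT (xi (k, i))).
  exact: (measurable_fun_pair2 (w : past k) (measurable_past_oracle j k0)).
exact: measurable_sample.
Qed.

Lemma ae_second_moment k i : (0 < k)%N -> (i < m)%N ->
  {ae P, forall w, (\int[P]_w' (dot (smp k w (xi (k, i) w'))
    (smp k w (xi (k, i) w')))%:E <= Mg%:E)%E}.
Proof.
move=> k0 im; have im' : (i < m_ k)%N by rewrite batch_constant.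
apply: filterS (second_moment.2 k i k0 im') => w.
by rewrite unlock; under eq_integral => w' _ do rewrite sqr_enorm.
Qed.

(** Decouples a weight known from the past from the fresh samples. It is used with the weights
    [alpha k * sqgrad k w] and [alpha k ^+ 2]. *)
Lemma integral_average_second_moment_le k (c : Omega -> R) : (0 < k)%N ->
  measurable_fun setT (c : past k -> R) -> (forall w, 0 <= c w) ->
  (\int[P]_w (c w * (m%:R^-1 * \sum_(i < m)
      dot (smp k w (xi (k, val i) w)) (smp k w (xi (k, val i) w))))%:E <=
   \int[P]_w (c w * Mg)%:E)%E.
Proof.
move=> k0 mc c0.
pose h (p : past k * Borel 'cV[R]_d) :=
  c p.1 * dot (smp k p.1 p.2) (smp k p.1 p.2).
have mh : measurable_fun setT h.
  apply: measurable_funM; first exact: measurableT_comp mc measurable_fst.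
  by apply: measurable_sum => j; apply: measurable_funM;
    exact: (measurable_past_oracle j k0).
under eq_integral => w _ do rewrite mulrCA mulr_sumr.
apply: (@integral_average_frozen_le _ _ _ Omega (past k) (Borel 'cV[R]_d) R P m
  id (fun i => xi (k, val i)) h (fun w => c w * Mg)) => //.
- exact: measurable_past_id.
- by move=> i; exact: (measurable_sample k0 (ltn_ord i)).
- by move=> i A B; exact: (past_sample_indep k0 (ltn_ord i)).
- by move=> p; rewrite mulr_ge0// dot_ge0.
- by apply: measurable_funM => //; exact: measurable_past mc.
- by move=> w; rewrite mulr_ge0// ltW.
- move=> i; apply: filterS (ae_second_moment k0 (ltn_ord i)) => w hw.
  rewrite /h/=; under eq_integral => w' _ do rewrite EFinM.
  rewrite ge0_integralZl_EFin//.
  + by rewrite EFinM; apply: lee_wpmul2l => //; rewrite lee_fin.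
  + by move=> w' _; rewrite lee_fin dot_ge0.
  + apply/measurable_EFinP; apply: measurable_sum => j.
    by apply: measurable_funM; exact: measurable_frozen_oracle.
Qed.

(** The gradient term stands on the left, so that both sides are nonnegative and no expectations are
    subtracted. The factor [kl] comes from the lower Loewner bound, [ku ^+ 2] from
    [sqr_enorm_mulmx]. *)
Lemma ae_frozen_descent_le k i : (0 < k)%N -> (i < m)%N ->
  {ae P, forall w, (\int[P]_w' (descent_bound k w (xi (k, i) w') +
      alpha k * kl * sqgrad k w)%:E <=
    (f (x k w) - flow + alpha k ^+ 2 * (L * ku ^+ 2 * Mg))%:E)%E}.
Proof.
move=> k0 im; have im' : (i < m_ k)%N by rewrite batch_constant.
apply: filterS3 (ubv_mean AS2 k0 im') (ae_second_moment k0 im) (ud_bounds AS3).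
move=> w mean second /(_ k k0)[lb ub].
have aH := sqn_posdef iteration w k0; have sH := posdef_semidef aH.
set a := alpha k; set A := H k w; set y := grad f (x k w).
have a0 : 0 <= a by exact/ltW/alpha_gt0.
(* The linear term is moved onto the sampled gradient [z] by [dot y (A *m z) = dot (A^T *m y) z],
   whence the vector [- (a *: (A^T *m y))]. *)
have := @integral_affine_quadratic_le _ _ _ P n
  (fun w' => smp k w (xi (k, i) w')) y Mg
  (fun j => measurable_frozen_oracle w j k0 im) mean second
  (fun w' => descent_bound k w (xi (k, i) w') + a * kl * sqgrad k w)
  (f (x k w) - flow + a * kl * dot y y) (a ^+ 2 * L * ku ^+ 2)
  (- (a *: (A^T *m y))).
move=> h; apply: le_trans (h _ _ _) _ => {h}.
- apply: measurable_funD => //; apply: measurable_funD.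
    apply: measurable_funB => //; apply: measurable_funM => //.
    apply: measurable_sum => j; apply: measurable_funM => //.
    under eq_fun do rewrite mxE; apply: measurable_sum => l.
    by apply: measurable_funM => //; exact: measurable_frozen_oracle.
  apply: measurable_funM => //; apply: measurable_sum => j.
  by apply: measurable_funM; under eq_fun do rewrite mxE;
    apply: measurable_sum => l; apply: measurable_funM => //;
    exact: measurable_frozen_oracle.
- by apply: mulr_ge0; [apply: mulr_ge0 => //|]; exact: sqr_ge0.
- move=> w'; set z := smp k w _.
  have q := sqr_enorm_mulmx z sH ku_gt0 ub.
  rewrite addr_ge0 ?descent_bound_ge0 ?mulr_ge0 ?dot_ge0 ?(ltW kl_gt0)//=.
  rewrite /descent_bound dotNl dotZl -dot_mulmx_tr -/z -/a -/A -/y.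
  have : a ^+ 2 * L * dot (A *m z) (A *m z) <= a ^+ 2 * L * (ku ^+ 2 * dot z z).
    by rewrite ler_wpM2l// mulr_ge0// sqr_ge0.
  by lra.
- rewrite lee_fin dotNl dotZl -dot_mulmx_tr.
  have : kl * dot y y <= dot y (A *m y).
    have := lb.2 y; rewrite mulmxBr mulmxBl mxE [X in _ + X]mxE subr_ge0.
    by rewrite -!mulmxA -!dotE mul_scalar_mx dotZr.
  by move=> /(ler_wpM2l a0); rewrite -/y -/A; lra.
Qed.

(** * Descent in expectation, summed over the iterations *)

Let gap_ge0 y : 0 <= f y - flow.
Proof. by rewrite subr_ge0 (sbb_lower AS1). Qed.

Let measurable_f k : (0 < k)%N -> measurable_fun setT (fun w => f (x k w)).
Proof. by move=> k0; exact: (measurable_past (measurable_past_f k0)). Qed.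

Lemma expected_descent k : (0 < k)%N ->
  (\int[P]_w (f (x k.+1 w) - flow + alpha k * kl * sqgrad k w)%:E <=
   \int[P]_w (f (x k w) - flow + alpha k ^+ 2 * (L * ku ^+ 2 * Mg))%:E)%E.
Proof.
move=> k0.
have mG := measurable_past (measurable_past_sqgrad k0).
have akl : 0 <= alpha k * kl by rewrite mulr_ge0 ?ltW// alpha_gt0.
have sq0 w : 0 <= alpha k * kl * sqgrad k w by rewrite mulr_ge0// dot_ge0.
(* The gradient term is constant in the sample, so it can be put inside [h]: averaging over the
   batch leaves it unchanged. *)
pose h (p : past k * Borel 'cV[R]_d) :=
  descent_bound k p.1 p.2 + alpha k * kl * sqgrad k p.1.
have mg1 (c : past k -> R) : measurable_fun setT c ->
    measurable_fun setT (fun p : past k * Borel 'cV[R]_d => c p.1).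
  by move=> mc; exact: measurableT_comp mc measurable_fst.
have mHg j : measurable_fun setT
    (fun p : past k * Borel 'cV[R]_d => (H k p.1 *m smp k p.1 p.2) j 0).
  under eq_fun do rewrite mxE; apply: measurable_sum => l.
  apply: measurable_funM; last exact: measurable_past_oracle.
  by apply: (mg1 (fun w => H k w j l)); exact: measurable_past_H.
have mh : measurable_fun setT h.
  apply: measurable_funD; last first.
    apply: measurable_funM => //.
    by apply: (mg1 (fun w => sqgrad k w)); exact: measurable_past_sqgrad.
  apply: measurable_funD.
    apply: measurable_funB.
      apply: measurable_funB => //.
      by apply: (mg1 (fun w => f (x k w))); exact: measurable_past_f.
    apply: measurable_funM => //; apply: measurable_sum => j.
    apply: measurable_funM => //.
    by apply: (mg1 (fun w => grad f (x k w) j 0)); exact: measurable_past_grad.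
  apply: measurable_funM => //; apply: measurable_sum => j.
  exact: measurable_funM.
apply: (@le_trans _ _ (\int[P]_w (m%:R^-1 *
    \sum_(i < m) h (w, xi (k, val i) w))%:E)%E).
  apply: ge0_le_integral => //.
  - by move=> w _; rewrite lee_fin addr_ge0.
  - apply/measurable_EFinP/measurable_funD; last exact: measurable_funM.
    by apply: measurable_funB => //; exact: measurable_f.
  - apply/measurable_EFinP/measurable_funM => //; apply: measurable_sum => i.
    apply: (@measurableT_comp _ _ _ _ _ _ h setT
      (fun w => (w, xi (k, val i) w) : past k * Borel 'cV[R]_d)) => //.
    apply: measurable_fun_pair; first exact: measurable_past_id.
    exact: (measurable_sample k0 (ltn_ord i)).
  - move=> w _; rewrite lee_fin /h/= big_split/= sumr_const card_ord.
    rewrite mulrDr mean_cst lerD2r.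
    exact: next_le_average_descent_bound.
apply: (@integral_average_frozen_le _ _ _ Omega (past k) (Borel 'cV[R]_d) R P m
  id (fun i => xi (k, val i)) h
  (fun w => f (x k w) - flow + alpha k ^+ 2 * (L * ku ^+ 2 * Mg))) => //.
- exact: measurable_past_id.
- by move=> i; exact: (measurable_sample k0 (ltn_ord i)).
- by move=> i A B; exact: (past_sample_indep k0 (ltn_ord i)).
- by move=> p; rewrite addr_ge0// descent_bound_ge0.
- by apply: measurable_funD => //; apply: measurable_funB => //; exact: measurable_f.
- by move=> w; rewrite addr_ge0// mulr_ge0 ?sqr_ge0.
- by move=> i; exact: (ae_frozen_descent_le k0 (ltn_ord i)).
Qed.

(** Telescopes [expected_descent] without subtraction: the induction carries [E N.+1] on the left,
    and its nonnegativity discards it at the end. *)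
Lemma weighted_sqgrad_le N :
  (\sum_(0 <= k < N) \int[P]_w (alpha k.+1 * kl * sqgrad k.+1 w)%:E <=
   (f x1 - flow +
    (\sum_(0 <= k < N) alpha k.+1 ^+ 2) * (L * ku ^+ 2 * Mg))%:E)%E.
Proof.
pose E k := (\int[P]_w (f (x k w) - flow)%:E)%E.
have E0 k : (0 <= E k)%E by apply: integral_ge0 => w _; rewrite lee_fin.
have mgap k : measurable_fun setT (fun w => (f (x k.+1 w) - flow)%:E).
  by apply/measurable_EFinP; apply: measurable_funB => //; exact: measurable_f.
pose a k := (\int[P]_w (alpha k.+1 * kl * sqgrad k.+1 w)%:E)%E.
rewrite -[X in (X <= _)%E]/(\sum_(0 <= k < N) a k)%E.
suff IH : (\sum_(0 <= k < N) a k + E N.+1 <= (f x1 - flow +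
    (\sum_(0 <= k < N) alpha k.+1 ^+ 2) * (L * ku ^+ 2 * Mg))%:E)%E.
  by apply: le_trans IH; rewrite leeDl.
elim: N => [|N IH].
  rewrite !big_geq// add0e mul0r addr0 /E.
  under eq_integral => w _ do rewrite (sqn_x1 iteration).
  by have := expectation_cst P (f x1 - flow); rewrite unlock => ->.
have mG := measurable_past (measurable_past_sqgrad (ltn0Sn N)).
have akl : 0 <= alpha N.+1 * kl by rewrite mulr_ge0 ?ltW// alpha_gt0.
have -> : (\sum_(0 <= k < N.+1) a k = \sum_(0 <= k < N) a k + a N)%E.
  by rewrite big_nat_recr.
rewrite big_nat_recr//= mulrDl [X in (_ <= X%:E)%E]addrA EFinD -addeA.
apply: le_trans (_ : _ <= \sum_(0 <= k < N) a k + (E N.+1 +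
  (alpha N.+1 ^+ 2 * (L * ku ^+ 2 * Mg))%:E))%E _; last first.
  by rewrite addeA leeD2r.
apply: leeD2l.
have := expected_descent (ltn0Sn N).
under eq_integral => w _ do rewrite EFinD.
under [in X in (_ <= X)%E -> _]eq_integral => w _ do rewrite EFinD.
rewrite ge0_integralD//; last 3 first.
- by move=> w _; rewrite lee_fin.
- by move=> w _; rewrite lee_fin mulr_ge0// dot_ge0.
- by apply/measurable_EFinP; exact: measurable_funM.
rewrite ge0_integralD//; last 2 first.
- by move=> w _; rewrite lee_fin.
- by move=> w _; rewrite lee_fin mulr_ge0// sqr_ge0.
have := expectation_cst P (alpha N.+1 ^+ 2 * (L * ku ^+ 2 * Mg)).
by rewrite unlock => ->; rewrite addeC.
Qed.

(** Almost every path satisfies the hypotheses of [cvg0_of_weighted_sums], with the root mean square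
    of the sampled gradients in the role of [N]. *)
Lemma ae_gradient_cvg0 :
  (\sum_(1 <= k <oo) (alpha k)%:E = +oo)%E ->
  (\sum_(1 <= k <oo) (alpha k ^+ 2)%:E < +oo)%E ->
  {ae P, forall w, enorm (grad f (x k w)) @[k --> \oo] --> (0 : R)}.
Proof.
move=> step_sum step_sq_sum.
have [A2 hA2] : exists A2, forall N, \sum_(0 <= k < N) alpha k.+1 ^+ 2 <= A2.
  have [|A2 hA2] := nneseries_lty_bounded _ step_sq_sum.
    by move=> k _; exact: sqr_ge0.
  (* Iterations start at 1, so [N] shifted terms are the original ones with index below [N.+1]. *)
  by exists A2 => N; have := hA2 N.+1; rewrite big_add1.
have adiv M : exists N, M < \sum_(0 <= k < N) alpha k.+1.
  apply: contrapT => /forallNP nM.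
  have : (\sum_(1 <= k <oo) (alpha k)%:E <= M%:E)%E.
    apply: nneseries_le_bound => [k k0|[|N]]; first exact/ltW/alpha_gt0.
      by have := nM 0%N; rewrite !big_geq// => /negP; rewrite -leNgt.
    by have := nM N; rewrite big_add1 => /negP; rewrite -leNgt.
  by rewrite step_sum leNgt ltry.
have c0 := noise_ge0.
(* The mean of the squares, not the square of the mean: it dominates the squared norm of the batch
   gradient and is linear in the samples' second moments. *)
pose Q k w := m%:R^-1 * \sum_(i < m)
  dot (smp k w (xi (k, val i) w)) (smp k w (xi (k, val i) w)).
have Q0 k w : 0 <= Q k w.
  by rewrite mulr_ge0 ?invr_ge0// sumr_ge0// => i _; exact: dot_ge0.
have mQ k : (0 < k)%N -> measurable_fun setT (Q k).
  move=> k0; apply: measurable_funM => //; apply: measurable_sum => i.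
  apply: measurable_sum => j; apply: measurable_funM;
  apply: (@measurableT_comp _ _ _ _ _ _ _ setT
      (fun w => (w, xi (k, val i) w) : past k * Borel 'cV[R]_d)
      (measurable_past_oracle j k0));
  by apply: measurable_fun_pair; [exact: measurable_past_id|
    exact: (measurable_sample k0 (ltn_ord i))].
(* The bound of [weighted_sqgrad_le] divided by [kl]; replacing [Q] by [Mg] in the weight [1 + Q]
   gives the factor [1 + Mg]. *)
pose B := (1 + Mg) * (kl^-1 * (f x1 - flow + A2 * (L * ku ^+ 2 * Mg))).
have mG k : measurable_fun setT ((fun w => alpha k.+1 * sqgrad k.+1 w) : past k.+1 -> R).
  by apply: measurable_funM => //; exact: measurable_past_sqgrad.
have ag0 k w : 0 <= alpha k.+1 * sqgrad k.+1 w.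
  by rewrite mulr_ge0 ?dot_ge0// ltW// alpha_gt0.
have int1 k : (\int[P]_w (alpha k.+1 * (sqgrad k.+1 w * (1 + Q k.+1 w)))%:E <=
    ((1 + Mg) * kl^-1)%:E * \int[P]_w (alpha k.+1 * kl * sqgrad k.+1 w)%:E)%E.
  have mGO := measurable_past (mG k).
  have le2 := integral_average_second_moment_le (ltn0Sn k) (mG k) (ag0 k).
  rewrite -ge0_integralZl_EFin//; last 3 first.
  - by move=> w _; rewrite lee_fin mulrAC mulr_ge0// ltW.
  - apply/measurable_EFinP; under eq_fun do rewrite mulrAC.
    exact: measurable_funM.
  - by rewrite mulr_ge0 ?addr_ge0 ?invr_ge0 ?ltW.
  have -> : (\int[P]_w (((1 + Mg) * kl^-1)%:E * (alpha k.+1 * kl * sqgrad k.+1 w)%:E) =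
      \int[P]_w ((alpha k.+1 * sqgrad k.+1 w)%:E + (alpha k.+1 * sqgrad k.+1 w * Mg)%:E))%E.
    apply: eq_integral => w _; rewrite -EFinM -EFinD; congr EFin.
    by field; rewrite gt_eqF.
  rewrite ge0_integralD//; last 4 first.
  - by move=> w _; rewrite lee_fin.
  - exact/measurable_EFinP.
  - by move=> w _; rewrite lee_fin mulr_ge0// ltW.
  - by apply/measurable_EFinP; exact: measurable_funM.
  have -> : (\int[P]_w (alpha k.+1 * (sqgrad k.+1 w * (1 + Q k.+1 w)))%:E =
      \int[P]_w ((alpha k.+1 * sqgrad k.+1 w)%:E +
                 (alpha k.+1 * sqgrad k.+1 w * Q k.+1 w)%:E))%E.
    by apply: eq_integral => w _; rewrite -EFinD; congr EFin; ring.
  rewrite ge0_integralD//; last 4 first.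
  - by move=> w _; rewrite lee_fin.
  - exact/measurable_EFinP.
  - by move=> w _; rewrite lee_fin mulr_ge0.
  - by apply/measurable_EFinP/measurable_funM => //; exact: mQ.
  exact: leeD2l.
have int2 k : (\int[P]_w (alpha k.+1 ^+ 2 * Q k.+1 w)%:E <=
    (alpha k.+1 ^+ 2 * Mg)%:E)%E.
  have := @integral_average_second_moment_le k.+1 (cst (alpha k.+1 ^+ 2))
    isT (measurable_cst _) (fun=> sqr_ge0 _).
  have := expectation_cst P (alpha k.+1 ^+ 2 * Mg).
  by rewrite unlock => ->.
have ae1 := @ae_bounded_partial_sums _ _ _ P
  (fun k w => alpha k.+1 * (sqgrad k.+1 w * (1 + Q k.+1 w))) B.
have ae2 := @ae_bounded_partial_sums _ _ _ P
  (fun k w => alpha k.+1 ^+ 2 * Q k.+1 w) (A2 * Mg).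
apply: filterS3 (ae1 _ _ _) (ae2 _ _ _) (ud_bounds AS3) => {ae1 ae2}.
- move=> w [A hA] [C hC] bnd.
  (* The shift discards index 0, where the iteration says nothing. *)
  rewrite -cvg_shiftS /=.
  apply: (@cvg0_of_weighted_sums R (fun k => alpha k.+1) _
    (fun k => Num.sqrt (Q k.+1 w)) (L * ku) A C 0%N) => //.
  + by move=> k _; exact/ltW/alpha_gt0.
  + by move=> k; exact: enorm_ge0.
  + by rewrite mulr_ge0// ltW.
  + move=> k _; have [lb ub] := bnd k.+1 isT.
    have ak := alpha_gt0 (ltn0Sn k).
    (* The gradient moves by at most [L] times the step length, and the step is at most [alpha * ku]
       times the norm of the batch gradient, itself below [Num.sqrt Q]. *)
    apply: le_trans (enorm_dist _ _) _.
    apply: le_trans (sbb_lipschitz AS1 _ _) _.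
    rewrite -mulrA; apply: ler_wpM2l => //.
    rewrite (sqn_next iteration)// addrC addKr -scaleN1r !enormZ normrN1 mul1r.
    rewrite gtr0_norm// mulrCA; apply: ler_wpM2l; first exact: ltW.
    apply: enorm_le; first by rewrite mulr_ge0 ?sqrtr_ge0// ltW.
    rewrite exprMn sqr_sqrtr//.
    apply: le_trans (sqr_enorm_mulmx _
      (posdef_semidef (sqn_posdef iteration w (ltn0Sn k))) ku_gt0 ub) _.
    apply: ler_wpM2l; first exact: sqr_ge0.
    rewrite batchE//; exact: sqr_enorm_mean.
  + by move=> N; under eq_bigr => k _ do rewrite sqr_enorm sqr_sqrtr//; exact: hA.
  + by move=> N; under eq_bigr => k _ do rewrite sqr_sqrtr//; exact: hC.
- move=> k; under eq_fun do rewrite mulrA.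
  apply: measurable_funM; first exact: measurable_past (mG k).
  by apply: measurable_funD => //; exact: mQ.
- by move=> k w; rewrite mulrA mulr_ge0// addr_ge0.
- move=> N; apply: (@le_trans _ _ (((1 + Mg) * kl^-1)%:E *
    \sum_(0 <= k < N) \int[P]_w (alpha k.+1 * kl * sqgrad k.+1 w)%:E)%E).
    rewrite ge0_sume_distrr; first by apply: lee_sum => k _; exact: int1.
    move=> k _; apply: integral_ge0 => w _.
    by rewrite lee_fin mulrAC mulr_ge0// ltW.
  rewrite /B (mulrA (1 + Mg)) [X in (_ <= X)%E]EFinM; apply: lee_wpmul2l.
    by rewrite lee_fin mulr_ge0 ?addr_ge0 ?invr_ge0 ?ltW.
  apply: le_trans (weighted_sqgrad_le N) _.
  by rewrite lee_fin lerD2l ler_wpM2r.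
- by move=> k; apply: measurable_funM => //; exact: mQ.
- by move=> k w; rewrite mulr_ge0// sqr_ge0.
- move=> N; apply: (@le_trans _ _ (\sum_(0 <= k < N) (alpha k.+1 ^+ 2 * Mg)%:E)%E).
    by apply: lee_sum => k _; exact: int2.
  by rewrite sumEFin lee_fin -mulr_suml ler_wpM2r// ltW.
Qed.

End SQN.

Theorem theorem2p2 (R : realType) (dO : measure_display)
  (Omega : measurableType dO) (P : probability Omega R) (n d : nat)
  (Xi : set 'cV[R]_d) (nu : probability (Borel 'cV[R]_d) R)
  (F : 'cV[R]_n * 'cV[R]_d -> R) (f : 'cV[R]_n -> R)
  (g : 'cV[R]_n -> 'cV[R]_d -> 'cV[R]_n)
  (m_ : nat -> nat) (m : nat) (xi : nat * nat -> Omega -> 'cV[R]_d)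
  (alpha : nat -> R) (x1 : 'cV[R]_n) (H1 : 'M[R]_n)
  (H : nat -> Omega -> 'M[R]_n) (x : nat -> Omega -> 'cV[R]_n)
  (L flow sigma kl ku Mg : R)
  (objective : stochastic_objective Xi nu F f)
  (oracle : stochastic_oracle P Xi g m_ xi)
  (iteration : sqn_iteration g m_ xi alpha x1 H1 H x)
  (AS1 : smooth_bounded_below f L flow)
  (AS2 : unbiased_bounded_variance P f g m_ xi x sigma)
  (AS3 : uniformly_definite P H kl ku)
  (AS4 : past_dependent m_ xi H)
  (batch_constant : forall k, (0 < k)%N -> m_ k = m)
  (step_sum : (\sum_(1 <= k <oo) (alpha k)%:E = +oo)%E)
  (step_sq_sum : (\sum_(1 <= k <oo) (alpha k ^+ 2)%:E < +oo)%E)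
  (step_bound : forall k, (0 < k)%N -> alpha k <= kl / (L * ku ^+ 2))
  (second_moment : bounded_second_moment P g m_ xi x Mg) :
  {ae P, forall w, enorm (grad f (x k w)) @[k --> \oo] --> (0 : R)}.
Proof.
exact: (ae_gradient_cvg0 oracle iteration AS1 AS2 AS3 AS4 batch_constant
  second_moment step_sum step_sq_sum).
Qed.
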